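(* Let $\alpha,\beta\in\mathbb C\setminus\mathbb R$ with $\alpha\neq\beta,\bar\beta$, and let $L,M\subset\mathbb C^n$ be isotropic lines. Then $$p_{\beta,\,p_{\alpha,L}(\beta)M}\;p_{\alpha,L}=p_{\alpha,\,p_{\beta,M}(\alpha)L}\;p_{\beta,M}.$$
   Context: Let $\langle\cdot,\cdot\rangle$ be the complex bilinear extension to $\mathbb C^n$ of the standard inner product on $\mathbb R^n$, and let $\perp$ denote orthogonality with respect to it. An isotropic line is a one-dimensional complex subspace on which $\langle\cdot,\cdot\rangle$ vanishes. For $\alpha\in\mathbb C\setminus\mathbb R$ and an isotropic line $L$, $$p_{\alpha,L}(\lambda)=\frac{\lambda-\bar\alpha}{\lambda-\alpha}\,\pi_{\bar L}+\pi_{(L\oplus\bar L)^\perp}+\frac{\lambda-\alpha}{\lambda-\bar\alpha}\,\pi_L,$$ with projections relative to $\mathbb C^n=L\oplus(L\oplus\bar L)^\perp\oplus\bar L$. For $\lambda\ne\alpha,\bar\alpha$, $p_{\alpha,L}(\lambda)\in\mathrm{SO}(n,\mathbb C)$, so it maps isotropic lines to isotropic lines. *)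

(* Defs.v *)
From HB Require Import structures.
From mathcomp Require Import all_boot all_order all_algebra.
From mathcomp Require Import reals.
From mathcomp Require Export complex.

Set Implicit Arguments.
Unset Strict Implicit.
Unset Printing Implicit Defensive.

Import Order.TTheory GRing.Theory Num.Theory.
Local Open Scope ring_scope.

Section SimpleFactors.
Variables (R : realType) (n : nat).
Local Notation C := R[i].
Local Notation V := 'cV[R[i]]_n.

(* Bilinear, not Hermitian: neither argument is conjugated. *)
Definition bilin (u v : V) : C := \sum_(i < n) u i 0 * v i 0.

Definition conjv (v : V) : V := map_mx (@conjc R) v.

(* See [mem_conjvs]: the conjugate of the chosen basis spans all of [conjv U]. *)
Definition conjvs (U : {vspace V}) : {vspace V} :=
  <<[seq conjv u | u <- vbasis U]>>%VS.

(* [linfun] needs the codomain C as a vector space over itself, whence [C^o]. *)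
Definition perp (U : {vspace V}) : {vspace V} :=
  (\bigcap_(u <- vbasis U) lker (linfun (bilin u : V -> C^o)))%VS.

Definition isotropic_line (L : {vspace V}) : Prop :=
  \dim L = 1%N /\ {in L &, forall u v, bilin u v = 0}.

(* [daddv_pi U W] is the projection onto [U] along [W] when U :&: W = 0.  The
   division is total, so the value is only meaningful when the point [lambda]
   is neither [alpha] nor its conjugate. *)
Definition simple_factor (alpha : C) (L : {vspace V}) (lambda : C) : 'End(V) :=
  let Lbar := conjvs L in
  let W := perp (L + Lbar)%VS in
  ((lambda - alpha^*%C) / (lambda - alpha)) *: daddv_pi Lbar (L + W)%VS
  + daddv_pi W (L + Lbar)%VS
  + ((lambda - alpha) / (lambda - alpha^*%C)) *: daddv_pi L (W + Lbar)%VS.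

Fact bilin_linear (u : V) : linear (bilin u : V -> C^o).
Proof.
move=> a v w; rewrite /bilin scaler_sumr -big_split; apply: eq_bigr => i _ /=.
by rewrite !mxE mulrDr mulrCA.
Qed.
HB.instance Definition _ (u : V) :=
  GRing.isLinear.Build C V C^o *:%R (bilin u : V -> C^o) (bilin_linear u).

Lemma bilinC (u v : V) : bilin u v = bilin v u.
Proof. by apply: eq_bigr => i _; rewrite mulrC. Qed.

Lemma conjvK : involutive conjv.
Proof. by move=> v; apply/matrixP => i j; rewrite !mxE conjcK. Qed.

Lemma mem_perp (U : {vspace V}) (v : V) :
  v \in perp U <-> {in U, forall u, bilin u v = 0}.
Proof.
have memb (s : seq V) :
    v \in (\bigcap_(u <- s) lker (linfun (bilin u : V -> C^o)))%VS
    <-> {in s, forall u, bilin u v = 0}.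
  elim: s => [|u s IHs]; first by rewrite big_nil memvf.
  rewrite big_cons memv_cap memv_ker lfunE /=; split.
    case/andP=> /eqP uv0 /IHs sv0 w; rewrite inE => /predU1P[-> //|].
    exact: sv0.
  move=> sv0; rewrite (sv0 u) ?mem_head // eqxx /=; apply/IHs => w ws.
  by apply: sv0; rewrite inE ws orbT.
split=> [/memb vb u uU | v0]; last first.
  by apply/memb => u /vbasis_mem; apply: v0.
rewrite (coord_vbasis uU) bilinC linear_sum big1 //= => i _.
rewrite linearZ /= bilinC vb ?scaler0 //.
by rewrite mem_nth // size_tuple.
Qed.

Lemma mem_conjvs (U : {vspace V}) (v : V) : (v \in conjvs U) = (conjv v \in U).
Proof.
have conjZD (I : finType) (a : I -> C) (w : I -> V) :
    conjv (\sum_i a i *: w i) = \sum_i (a i)^*%C *: conjv (w i).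
  by rewrite /conjv map_mx_sum; apply: eq_bigr => i _; rewrite map_mxZ.
apply/idP/idP => [|vU].
  move=> /(@coord_span _ _ _ (map_tuple conjv (vbasis U))) ->.
  rewrite conjZD; apply: memv_suml => i _; apply: memvZ.
  rewrite (nth_map 0) ?size_tuple // conjvK.
  by apply: vbasis_mem; rewrite mem_nth // size_tuple.
rewrite -[v]conjvK (coord_vbasis vU) conjZD; apply: memv_suml => i _.
apply/memvZ/memv_span/map_f.
by rewrite mem_nth // size_tuple.
Qed.

Lemma bilin_conjv (u v : V) : bilin (conjv u) (conjv v) = (bilin u v)^*%C.
Proof.
by rewrite /bilin rmorph_sum; apply: eq_bigr => i _; rewrite !mxE rmorphM.
Qed.

Lemma bilin_conjv_eq0 (u : V) : bilin u (conjv u) = 0 -> u = 0.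
Proof.
have pos (i : 'I_n) : 0 <= u i 0 * conjv u i 0 by rewrite mxE mul_conjC_ge0.
move=> /eqP; rewrite psumr_eq0 // => /allP u0; apply/matrixP => i j.
rewrite ord1 mxE; apply/eqP; rewrite -mul_conjC_eq0.
by have := u0 i (mem_index_enum _); rewrite mxE.
Qed.

(* The decomposition L (+) (L (+) Lbar)^perp (+) Lbar, in the form required by
   the three uses of [daddv_pi] in [simple_factor]. *)
Lemma isotropic_decomposition (L : {vspace V}) :
  isotropic_line L ->
  let Lbar := conjvs L in let W := perp (L + Lbar)%VS in
  [/\ (L + W + Lbar)%VS = fullv, (L :&: (W + Lbar) = 0)%VS,
      (W :&: (L + Lbar) = 0)%VS & (Lbar :&: (L + W) = 0)%VS].
Proof.
move=> [dimL isoL] Lbar W.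
have isoLb : {in Lbar &, forall u v, bilin u v = 0}.
  move=> u v; rewrite !mem_conjvs => uL vL; apply: (can_inj (@conjcK R)).
  by rewrite -bilin_conjv isoL // conjc0.
have cL u : u \in L -> conjv u \in Lbar by rewrite mem_conjvs conjvK.
have cLb u : u \in Lbar -> conjv u \in L by rewrite mem_conjvs.
have LW u w : u \in L -> w \in W -> bilin u w = 0.
  by move=> uL /mem_perp; apply; apply: subvP uL; apply: addvSl.
have LbW u w : u \in Lbar -> w \in W -> bilin u w = 0.
  by move=> uL /mem_perp; apply; apply: subvP uL; apply: addvSr.
have dis (A B : {vspace V}) :
    (forall x, x \in A -> x \in B -> x = 0) -> (A :&: B = 0)%VS.
  move=> AB0; apply/eqP; rewrite -subv0; apply/subvP => x.
  by rewrite memv_cap => /andP[xA xB]; rewrite memv0 (AB0 x).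
split.
- apply/eqP; rewrite eqEsubv subvf /=; apply/subvP => v _.
  have : L != 0%VS by rewrite -dimv_eq0 dimL.
  rewrite -vpick0; set l := vpick L => l0.
  have lL : l \in L by apply: memv_pick.
  have defL : L = <[l]>%VS.
    by apply/esym/eqP; rewrite eqEdim dimL dim_vline l0 -memvE lL.
  have d0 : bilin l (conjv l) != 0 by apply: contra_neq l0 => /bilin_conjv_eq0.
  pose d := bilin l (conjv l); pose lb := conjv l.
  pose a := bilin lb v / d; pose b := bilin l v / d.
  have -> : v = a *: l + (v - a *: l - b *: lb) + b *: lb.
    by rewrite -[RHS]addrA subrK addrC subrK.
  apply: memv_add; last by rewrite memvZ ?cL.
  apply: memv_add; first by rewrite memvZ.
  apply/mem_perp => x /memv_addP[x1 x1L [x2 x2L ->]].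
  have x2L' := cLb _ x2L; move: x1L x2L'; rewrite defL => /vlineP[k ->].
  move=> /vlineP[k' /(congr1 conjv)]; rewrite conjvK => ->.
  have -> : conjv (k' *: l) = k'^*%C *: lb by rewrite /conjv map_mxZ.
  have ll : bilin l l = 0 by apply: isoL.
  have bb : bilin lb lb = 0 by apply: isoLb; apply: cL.
  have E1 : bilin l (v - a *: l - b *: lb) = 0.
    rewrite !linearB !linearZ /= ll oppr0 scaler0 addr0 scalerN.
    by rewrite /GRing.scale /= divfK // subrr.
  have E2 : bilin lb (v - a *: l - b *: lb) = 0.
    rewrite !linearB !linearZ /= bb oppr0 scaler0 addr0 scalerN (bilinC lb l).
    by rewrite /GRing.scale /= divfK // subrr.
  move: (v - _ - _) E1 E2 => w E1 E2.
  by rewrite bilinC linearD !linearZ /= !(bilinC w) E1 E2 !scaler0 addr0.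
- apply: dis => x xL /memv_addP[w wW [b bL xE]]; apply: bilin_conjv_eq0.
  by rewrite bilinC {2}xE linearD /= LbW ?isoLb ?addr0 ?cL.
- apply: dis => x xW /memv_addP[a aL [b bL xE]].
  have a0 : a = 0.
    have := LbW _ _ (cL _ aL) xW; rewrite xE linearD /= (isoLb _ b) ?cL // addr0.
    by rewrite bilinC => /bilin_conjv_eq0.
  have b0 : b = 0.
    have := LW _ _ (cLb _ bL) xW; rewrite xE linearD /= (isoL _ a) ?cLb // add0r.
    by rewrite bilinC => /bilin_conjv_eq0.
  by rewrite xE a0 b0 addr0.
- apply: dis => x xL /memv_addP[a aL [w wW xE]]; apply: bilin_conjv_eq0.
  by rewrite bilinC {2}xE linearD /= (LW _ w) ?isoL ?addr0 ?cLb.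
Qed.

End SimpleFactors.

(* Main.v *)
Require Import Defs.
From mathcomp Require Import all_boot all_order all_algebra.
From mathcomp Require Import reals complex.
From mathcomp Require Import ring.
Import Order.TTheory GRing.Theory Num.Theory.
Local Open Scope ring_scope.

(** Write [<u, v>] for the bilinear form.  If [l] spans the isotropic line [L]
    and [l'] is its conjugate, then [<l, l'> != 0] and the simple factor is
    [[
      p(t) v = v + (a - a') / <l, l'>
                   ( <l, v> / (t - a) l' - <l', v> / (t - a') l ),
    ]]
    where [a'] is the conjugate of [a] ([simple_factorE]).  The right-hand side
    makes sense for arbitrary scalars [a], [a'] and for any pair of isotropic
    vectors [l], [l'] with [<l, l'> != 0]; it is [pair_factor] below, and in
    this form the theorem is a statement of linear algebra over a field.

    As functions of [t], both sides of the identity are [1] at infinity and have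
    simple poles at [a], [a'], [b], [b'], so only residues have to be compared.
    Let [P], [Q] be the factors of [(a, l)] and [(b, m)], let [M = P(b) m],
    [M' = P(b') m'], [N = Q(a) l], [N' = Q(a') l'], and let [P1], [Q1] be the
    factors of [(a, N)] and [(b, M)].  In [Q1 P] the residue at [b] is a
    multiple of [v |-> <M, P(b) v> M'], and [<M, P(b) v> = <m, v>] because [P(b)]
    preserves the form.  The residue at [a] is a multiple of
    [v |-> <l, v> Q1(a) l'], and the key fact ([pair_factor_exchange]) is that
    [Q1(a) l'] is proportional to [N'], with the same ratio by which the norming
    constant [<l, l'>] differs from [<N, N'>] ([pair_factor_gram]).  Hence
    [[
      Q1(t) P(t) v
        = v + (a - a') / <N, N'> ( <l, v> / (t - a) N' - <l', v> / (t - a') N )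
            + (b - b') / <M, M'> ( <m, v> / (t - b) M' - <m', v> / (t - b') M )
    ]]
    ([pair_factor_comp_sym]).  This expression does not change when the two
    families of data are exchanged, and the exchange turns [Q1 P] into
    [P1 Q]. *)

(** * Sums and composites of linear maps *)

Section LinearMaps.
Set Implicit Arguments.
Unset Strict Implicit.
Variables (K : fieldType) (vT : vectType K).

Lemma daddv_pi_unique (U W : {vspace vT}) (v u w : vT) :
  (U :&: W = 0)%VS -> v = u + w -> u \in U -> w \in W -> daddv_pi U W v = u.
Proof.
move=> UW0 -> uU wW; rewrite linearD /= daddv_pi_id //.
have wUW : w \in (U + W)%VS by apply: subvP wW; apply: addvSr.
have := daddv_pi_add UW0 wUW; rewrite (daddv_pi_id _ wW) 1?capvC //.
by move/(canRL (addrK _)); rewrite subrr => ->; rewrite addr0.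
Qed.

Lemma lfun_comb3 (wT : vectType K) (f g h : 'Hom(vT, wT))
    (p q : K) (v : vT) (x y z : wT) :
  f v = x -> g v = y -> h v = z ->
  (p *: f + g + q *: h)%VF v = p *: x + y + q *: z.
Proof. by move=> <- <- <-; rewrite !add_lfunE !scale_lfunE. Qed.

(** Pointwise descriptions of the four maps are enough.  Stating this, like the
    previous lemma, over an abstract vector type keeps the algebraic structures
    of the complex numbers out of the rewriting. *)
Lemma eq_comp_lfun (f g f' g' : 'End(vT)) (F G F' G' : vT -> vT) :
    f =1 F -> g =1 G -> f' =1 F' -> g' =1 G' -> F \o G =1 F' \o G' ->
  (f \o g)%VF = (f' \o g')%VF.
Proof.
move=> fF gG f'F' g'G' FG; apply/lfunP => v.
by rewrite !comp_lfunE fF gG f'F' g'G'; apply: FG.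
Qed.

End LinearMaps.

(** * Factors attached to pairs of isotropic vectors *)

Section PairFactor.
Set Implicit Arguments.
Unset Strict Implicit.
Variables (F : fieldType) (n : nat).
Local Notation V := 'cV[F]_n.
Variable B : V -> V -> F.
Hypotheses (BC : forall u v, B u v = B v u)
  (BDr : forall u, {morph B u : v w / v + w})
  (BZr : forall u a v, B u (a *: v) = a * B u v).
Implicit Types (a b t : F) (l m u v w : V).

Lemma formBr u v w : B u (v - w) = B u v - B u w.
Proof. by rewrite -scaleN1r BDr BZr mulN1r. Qed.

(** The simple factor as a sum over its two poles, with [a'] and [l'] free
    instead of conjugate to [a] and [l]. *)
Definition pair_factor a a' l l' t v : V :=
  v + ((a - a') / B l l') *:
    ((B l v / (t - a)) *: l' - (B l' v / (t - a')) *: l).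

(** Every fact about the pole [a] thus gives one about the pole [a']. *)
Lemma pair_factorC a a' l l' t v :
  pair_factor a a' l l' t v = pair_factor a' a l' l t v.
Proof.
rewrite /pair_factor (BC l' l) -(opprB a a') mulNr scaleNr -scalerN.
by rewrite opprB.
Qed.

Lemma form_pair_factor a a' l l' t u v :
  B u (pair_factor a a' l l' t v) =
  B u v + (a - a') / B l l' *
    (B l v / (t - a) * B l' u - B l' v / (t - a') * B l u).
Proof. by rewrite /pair_factor BDr BZr formBr !BZr !(BC u). Qed.

Definition isotropic_pair l l' := [/\ B l l = 0, B l' l' = 0 & B l l' != 0].

Lemma isotropic_pairC l l' : isotropic_pair l l' -> isotropic_pair l' l.
Proof. by case=> ll l'l' ll'; split=> //; rewrite BC. Qed.

(** The spectral form of the factor, which is how the simple factors are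
    defined. *)
Lemma pair_factor_eigen a a' l l' t x y w :
    isotropic_pair l l' -> t != a -> t != a' -> B l w = 0 -> B l' w = 0 ->
  pair_factor a a' l l' t (x *: l + w + y *: l') =
  ((t - a') / (t - a)) *: (y *: l') + w + ((t - a) / (t - a')) *: (x *: l).
Proof.
case=> ll l'l' d0 ta ta' lw l'w.
rewrite /pair_factor !BDr !BZr ll lw l'l' l'w (BC l' l).
by apply/matrixP => i j; rewrite !mxE; field; rewrite !subr_eq0 ta ta' d0.
Qed.

Lemma pair_factor_isometry a a' l l' t u v :
    isotropic_pair l l' -> t != a -> t != a' ->
  B (pair_factor a a' l l' t u) (pair_factor a a' l l' t v) = B u v.
Proof.
case=> ll l'l' d0; rewrite -(subr_eq0 t a) -(subr_eq0 t a') => ta ta'.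
rewrite form_pair_factor (BC (pair_factor _ _ _ _ _ _) v).
rewrite !form_pair_factor ll l'l' (BC l' l) (BC u v).
by field; rewrite d0 ta ta'.
Qed.

Lemma form_pair_factor2 a a' b b' l l' m m' :
    isotropic_pair l l' -> a != b -> a != b' -> a' != b -> a' != b' ->
  B (pair_factor a a' l l' b m) (pair_factor a a' l l' b' m') =
  B m m' + (a - a') * (b - b') / B l l' *
    (B l m * B l' m' / ((a - b) * (b' - a'))
     - B l m' * B l' m / ((a - b') * (b - a'))).
Proof.
move=> [ll l'l' d0] ab ab' a'b a'b'.
rewrite form_pair_factor !(BC (pair_factor _ _ _ _ _ _)) !form_pair_factor.
rewrite ll l'l' (BC l' l) !(BC m) !(BC m').
field; rewrite !subr_eq0 !(eq_sym _ a) !(eq_sym _ a').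
by rewrite d0 ab ab' a'b a'b'.
Qed.

(** Multiplying [form_pair_factor2] by [B l l'] makes it symmetric in the two
    families of data: transforming either pair by the factor of the other
    changes the two norming constants in the same ratio. *)
Lemma pair_factor_gram a a' b b' l l' m m' :
    isotropic_pair l l' -> isotropic_pair m m' ->
    a != b -> a != b' -> a' != b -> a' != b' ->
  B l l' * B (pair_factor a a' l l' b m) (pair_factor a a' l l' b' m') =
  B m m' * B (pair_factor b b' m m' a l) (pair_factor b b' m m' a' l').
Proof.
move=> lP mP ab ab' a'b a'b'.
have [ba ba' b'a b'a'] : [/\ b != a, b != a', b' != a & b' != a'].
  by rewrite !(eq_sym b) !(eq_sym b').
rewrite !form_pair_factor2 // !(BC m) !(BC m').
have [[_ _ d0] [_ _ e0]] := (lP, mP).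
by field; rewrite !subr_eq0 d0 e0 ?(ab, ab', a'b, a'b', ba, ba', b'a, b'a').
Qed.

(** The residue comparison.  The new factor of the pair [(M, M')], at the pole
    [a'] of the first factor, moves [l] in the same direction as the old factor
    of [(m, m')] moves it at the other pole [a].  In the difference of the two
    sides, the terms along [l'] cancel, those along [m] and [m'] agree at once,
    and those along [l] agree by the formula for [B M M']. *)
Lemma pair_factor_exchange a a' b b' l l' m m'
    (M := pair_factor a a' l l' b m) (M' := pair_factor a a' l l' b' m') :
    isotropic_pair l l' -> isotropic_pair m m' ->
    a != b -> a != b' -> a' != b -> a' != b' -> B M M' != 0 ->
  pair_factor b b' M M' a' l =
  (B m m' / B M M') *: pair_factor b b' m m' a l.
Proof.
move=> lP [mm m'm' e0] ab ab' a'b a'b' E0.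
have EE := form_pair_factor2 m m' lP ab ab' a'b a'b'.
have [ll l'l' d0] := lP.
apply/matrixP => i j; rewrite {1 2}/pair_factor !mxE.
rewrite -/M -/M' in EE.
set E := B M M' in E0 EE *.
rewrite (BC M) (BC M') !form_pair_factor ll (BC l' l).
(* The formula for E is substituted only once E has left the denominators. *)
have clearE x k c y z : E * x + k * y = c * z -> x + k / E * y = c / E * z.
  by move=> cz; rewrite [RHS]mulrAC -cz; field.
apply: clearE; rewrite {}EE !(BC m) !(BC m').
field; rewrite !subr_eq0 !(eq_sym _ a) !(eq_sym _ a').
by rewrite d0 ab ab' a'b a'b' e0.
Qed.

(** The partial fraction expansion in [t] of a product of two factors: each
    residue is the residue of one factor composed with the value of the other
    at that pole. *)
Lemma pair_factor_comp a a' b b' l l' m m' t v :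
    t != a -> t != a' -> t != b -> t != b' ->
    a != b -> a != b' -> a' != b -> a' != b' ->
    B l l' != 0 -> B m m' != 0 ->
  pair_factor b b' m m' t (pair_factor a a' l l' t v) =
  v + ((a - a') / B l l') *:
        ((B l v / (t - a)) *: pair_factor b b' m m' a l'
         - (B l' v / (t - a')) *: pair_factor b b' m m' a' l)
    + ((b - b') / B m m') *:
        ((B m (pair_factor a a' l l' b v) / (t - b)) *: m'
         - (B m' (pair_factor a a' l l' b' v) / (t - b')) *: m).
Proof.
move=> ta ta' tb tb' ab ab' a'b a'b' d0 e0.
rewrite {1}/pair_factor !form_pair_factor /pair_factor.
apply/matrixP => i j; rewrite !mxE !(BC m) !(BC m').
field; rewrite !subr_eq0 !(eq_sym _ a) !(eq_sym _ a').
rewrite !(eq_sym a t) !(eq_sym a' t).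
by rewrite d0 ta ta' tb tb' ab ab' a'b a'b' e0.
Qed.

(** The values at the poles left by [pair_factor_comp] are evaluated: those of
    the first factor by isometry, those of the second by exchange. *)
Lemma pair_factor_comp_sym a a' b b' l l' m m' t v
    (M := pair_factor a a' l l' b m) (M' := pair_factor a a' l l' b' m')
    (N := pair_factor b b' m m' a l) (N' := pair_factor b b' m m' a' l') :
    isotropic_pair l l' -> isotropic_pair m m' ->
    t != a -> t != a' -> t != b -> t != b' ->
    a != b -> a != b' -> a' != b -> a' != b' -> B M M' != 0 ->
  pair_factor b b' M M' t (pair_factor a a' l l' t v) =
  v + ((a - a') / B N N') *:
        ((B l v / (t - a)) *: N' - (B l' v / (t - a')) *: N)
    + ((b - b') / B M M') *:
        ((B m v / (t - b)) *: M' - (B m' v / (t - b')) *: M).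
Proof.
move=> lP mP ta ta' tb tb' ab ab' a'b a'b' E0.
have [_ _ d0] := lP; have [_ _ e0] := mP.
have NE : B l l' * B M M' = B m m' * B N N' by apply: pair_factor_gram.
have N0 : B N N' != 0.
  by have := mulf_neq0 d0 E0; rewrite NE mulf_eq0 negb_or => /andP[].
have [ba ba' b'a b'a'] : [/\ b != a, b != a', b' != a & b' != a'].
  by rewrite !(eq_sym b) !(eq_sym b').
have exN : pair_factor b b' M M' a' l = (B m m' / B M M') *: N.
  exact: pair_factor_exchange.
have exN' : pair_factor b b' M M' a l' = (B m m' / B M M') *: N'.
  rewrite /M /M' !(pair_factorC a a') in E0 *.
  by rewrite /N' pair_factor_exchange //; apply: isotropic_pairC.
have coefE : (a - a') / B l l' * (B m m' / B M M') = (a - a') / B N N'.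
  have ->: B M M' = B m m' * B N N' / B l l'.
    by rewrite -NE mulrAC divff // mul1r.
  by field; rewrite d0 e0 N0.
rewrite (pair_factor_comp _ ta ta' tb tb' ab ab' a'b a'b' d0 E0).
rewrite exN exN' (pair_factor_isometry _ _ lP ba ba').
rewrite (pair_factor_isometry _ _ lP b'a b'a') -coefE.
set D := B m m' / B M M'.
by rewrite !scalerBr !scalerA -!(mulrA _ D) !(mulrC D).
Qed.

(** [M'] and [N'] are given by equations so that, in the complex case, they can
    be the conjugates of [M] and [N]. *)
Lemma pair_factor_permutability a a' b b' l l' m m' M' N' t
    (M := pair_factor a a' l l' b m) (N := pair_factor b b' m m' a l) :
    isotropic_pair l l' -> isotropic_pair m m' ->
    M' = pair_factor a a' l l' b' m' -> N' = pair_factor b b' m m' a' l' ->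
    t != a -> t != a' -> t != b -> t != b' ->
    a != b -> a != b' -> a' != b -> a' != b' -> B M M' != 0 ->
  pair_factor b b' M M' t \o pair_factor a a' l l' t =1
  pair_factor a a' N N' t \o pair_factor b b' m m' t.
Proof.
move=> lP mP -> -> ta ta' tb tb' ab ab' a'b a'b' E0 v /=.
have [_ _ d0] := lP; have [_ _ e0] := mP.
have N0 : B N (pair_factor b b' m m' a' l') != 0.
  have : B m m' * B N (pair_factor b b' m m' a' l') != 0.
    by rewrite -pair_factor_gram // mulf_neq0.
  by rewrite mulf_eq0 negb_or => /andP[].
have [ba ba' b'a b'a'] : [/\ b != a, b != a', b' != a & b' != a'].
  by rewrite !(eq_sym b) !(eq_sym b').
rewrite (pair_factor_comp_sym v lP mP ta ta' tb tb' ab ab' a'b a'b' E0).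
rewrite (pair_factor_comp_sym v mP lP tb tb' ta ta' ba ba' b'a b'a' N0).
exact: addrAC.
Qed.

End PairFactor.

(** * Isotropic lines *)

Section Lines.
Set Implicit Arguments.
Unset Strict Implicit.
Variables (R : realType) (n : nat).
Local Notation C := R[i].
Local Notation V := 'cV[R[i]]_n.
Implicit Types (a b t : C) (l m u v w : V).

Lemma bilinDr u : {morph bilin u : v w / v + w}.
Proof. exact: linearD. Qed.

Lemma bilinZr u a v : bilin u (a *: v) = a * bilin u v.
Proof. exact: linearZ. Qed.

(** The reality condition: conjugating a transformed vector amounts to
    transforming the conjugate vector at the conjugate point. *)
Lemma conjv_pair_factor a l b m :
  conjv (pair_factor (@bilin R n) a a^*%C l (conjv l) b m) =
  pair_factor (@bilin R n) a a^*%C l (conjv l) b^*%C (conjv m).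
Proof.
have conjvD u v : conjv (u + v) = conjv u + conjv v by apply: map_mxD.
have conjvB u v : conjv (u - v) = conjv u - conjv v by apply: map_mxB.
have conjvZ x v : conjv (x *: v) = x^*%C *: conjv v by apply: map_mxZ.
have conjCM (x y : C) : (x / y)^*%C = x^*%C / y^*%C by apply: fmorph_div.
have conjCB (x y : C) : (x - y)^*%C = x^*%C - y^*%C by apply: rmorphB.
rewrite [RHS]pair_factorC; last exact: bilinC.
rewrite /pair_factor conjvD conjvZ conjvB !conjvZ !conjCM !conjCB.
by rewrite -!bilin_conjv !conjvK conjcK.
Qed.

Lemma isotropic_pair_conjv l :
  bilin l l = 0 -> l != 0 -> isotropic_pair (@bilin R n) l (conjv l).
Proof.
move=> ll l0; split=> //; first by rewrite bilin_conjv ll conjc0.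
by apply: contra_neq l0 => /bilin_conjv_eq0.
Qed.

Lemma isotropic_line_gen (L : {vspace V}) :
  isotropic_line L -> {l | L = <[l]>%VS & bilin l l = 0 /\ l != 0}.
Proof.
move=> [dimL isoL]; exists (vpick L).
  apply/esym/eqP; rewrite eqEdim dimL dim_vline -memvE memv_pick.
  by rewrite vpick0 -dimv_eq0 dimL.
split; first by apply: isoL; apply: memv_pick.
by rewrite vpick0 -dimv_eq0 dimL.
Qed.

Lemma isotropic_line_vline l :
  bilin l l = 0 -> l != 0 -> isotropic_line <[l]>%VS.
Proof.
move=> ll l0; split; first by rewrite dim_vline l0.
move=> u v /vlineP[x ->] /vlineP[y ->].
by rewrite bilinZr bilinC bilinZr ll !mulr0.
Qed.

(** Along the isotropic decomposition [v = x l + w + y l'], each of the three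
    projections selects its component, and [pair_factor_eigen] applies. *)
Lemma simple_factorE a l t (L : {vspace V}) :
    L = <[l]>%VS -> bilin l l = 0 -> l != 0 -> t != a -> t != a^*%C ->
  simple_factor a L t =1 pair_factor (@bilin R n) a a^*%C l (conjv l) t.
Proof.
move=> -> ll l0 ta ta' v.
have [_ l'l' d0] := isotropic_pair_conjv ll l0.
have [] := isotropic_decomposition (isotropic_line_vline ll l0).
rewrite /simple_factor.
set Lb := conjvs _; set W := perp _; set piL := daddv_pi <[l]> _.
set piW := daddv_pi W _; set piLb := daddv_pi Lb _ => full disL disW disLb.
have : v \in (<[l]> + W + Lb)%VS by rewrite full memvf.
move=> /memv_addP[_ /memv_addP[_ /vlineP[x ->] [w wW ->]] [z zLb vE]].
have [y zE] : exists y, z = y *: conjv l.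
  move: zLb; rewrite mem_conjvs => /vlineP[y yE]; exists y^*%C.
  by rewrite -[z]conjvK yE /conjv map_mxZ.
have lL : l \in <[l]>%VS by rewrite memv_line.
have l'Lb : conjv l \in Lb by rewrite mem_conjvs conjvK.
have lw : bilin l w = 0.
  by move/mem_perp: wW; apply; apply: subvP lL; apply: addvSl.
have l'w : bilin (conjv l) w = 0.
  by move/mem_perp: wW; apply; apply: subvP l'Lb; apply: addvSr.
have piLE : piL v = x *: l.
  apply: (@daddv_pi_unique _ _ _ _ _ _ (w + z)); rewrite ?memvZ //.
    by rewrite addrA.
  exact: memv_add.
have piLbE : piLb v = z.
  apply: (@daddv_pi_unique _ _ _ _ _ _ (x *: l + w)) => //; first by rewrite addrC.
  by rewrite memv_add ?memvZ.
have piWE : piW v = w.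
  apply: (@daddv_pi_unique _ _ _ _ _ _ (x *: l + z)) => //.
    by rewrite vE (addrC (x *: l)) addrA.
  by rewrite memv_add ?memvZ.
rewrite (lfun_comb3 _ _ piLbE piWE piLE) vE zE.
by rewrite (pair_factor_eigen (@bilinC R n) bilinDr bilinZr) //.
Qed.

(** Preservation of the form gives isotropy of the image, and also that it is
    nonzero, since [m] pairs nontrivially with its conjugate. *)
Lemma pair_factor_isotropic a b l m
    (M := pair_factor (@bilin R n) a a^*%C l (conjv l) b m) :
    bilin l l = 0 -> l != 0 -> bilin m m = 0 -> m != 0 ->
    b != a -> b != a^*%C ->
  bilin M M = 0 /\ M != 0.
Proof.
move=> ll l0 mm m0 ba ba'; have lP := isotropic_pair_conjv ll l0.
have isoM := pair_factor_isometry (@bilinC R n) bilinDr bilinZr _ _ lP ba ba'.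
split; first by rewrite isoM.
have [_ _ e0] := isotropic_pair_conjv mm m0.
apply: contra_neq e0 => M0.
by rewrite -isoM -/M M0 bilinC -(scale0r 0) bilinZr mul0r.
Qed.

Lemma simple_factor_line a b l m (L M : {vspace V}) :
    L = <[l]>%VS -> M = <[m]>%VS ->
    bilin l l = 0 -> l != 0 -> b != a -> b != a^*%C ->
  (simple_factor a L b @: M)%VS =
  <[pair_factor (@bilin R n) a a^*%C l (conjv l) b m]>%VS.
Proof.
move=> -> -> ll l0 ba ba'; rewrite -(simple_factorE erefl ll l0 ba ba').
exact: limg_line.
Qed.

(** The transformed lines are variables here for the sake of unification: the
    subspaces [L] and [M] may then be any terms equal to the spans of [l] and
    [m]. *)
Lemma simple_factor_permutability a b l m t (L M L1 M1 : {vspace V}) :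
    bilin l l = 0 -> l != 0 -> bilin m m = 0 -> m != 0 ->
    L = <[l]>%VS -> M = <[m]>%VS ->
    M1 = <[pair_factor (@bilin R n) a a^*%C l (conjv l) b m]>%VS ->
    L1 = <[pair_factor (@bilin R n) b b^*%C m (conjv m) a l]>%VS ->
    a != b -> a != b^*%C -> t \notin [:: a; a^*%C; b; b^*%C] ->
  (simple_factor b M1 t \o simple_factor a L t)%VF =
  (simple_factor a L1 t \o simple_factor b M t)%VF.
Proof.
move=> ll l0 mm m0 LE ME M1E L1E ab ab'.
rewrite !inE !negb_or => /and4P[ta ta' tb tb'].
have conjI : injective (@conjc R) := can_inj (@conjcK R).
have a'b' : a^*%C != b^*%C by rewrite (inj_eq conjI).
have a'b : a^*%C != b by rewrite -(inj_eq conjI) conjcK.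
have [ba ba'] : b != a /\ b != a^*%C by rewrite !(eq_sym b).
have [MM M0] := pair_factor_isotropic ll l0 mm m0 ba ba'.
have [NN N0] := pair_factor_isotropic mm m0 ll l0 ab ab'.
have [_ _ E0] := isotropic_pair_conjv MM M0.
have lP := isotropic_pair_conjv ll l0; have mP := isotropic_pair_conjv mm m0.
apply: (eq_comp_lfun (simple_factorE M1E MM M0 tb tb')
  (simple_factorE LE ll l0 ta ta') (simple_factorE L1E NN N0 ta ta')
  (simple_factorE ME mm m0 tb tb')).
exact: (pair_factor_permutability (@bilinC R n) bilinDr bilinZr
          lP mP (conjv_pair_factor _ _ _ _) (conjv_pair_factor _ _ _ _)
          ta ta' tb tb' ab ab' a'b a'b' E0).
Qed.

End Lines.

Theorem corollary5p3 (R : realType) (n : nat) (alpha beta : R[i])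
    (L M : {vspace 'cV[R[i]]_n})
    (alpha_nonreal : alpha \isn't Num.real)
    (beta_nonreal : beta \isn't Num.real)
    (neq_alpha_beta : alpha != beta)
    (neq_alpha_conj_beta : alpha != beta^*%C)
    (isoL : isotropic_line L) (isoM : isotropic_line M) :
  forall lambda : R[i],
    lambda \notin [:: alpha; alpha^*%C; beta; beta^*%C] ->
    (simple_factor beta (simple_factor alpha L beta @: M)%VS lambda
       \o simple_factor alpha L lambda)%VF
    = (simple_factor alpha (simple_factor beta M alpha @: L)%VS lambda
       \o simple_factor beta M lambda)%VF.
Proof.
move=> t t_notin.
have [l LE [ll l0]] := isotropic_line_gen isoL.
have [m ME [mm m0]] := isotropic_line_gen isoM.
have ba : beta != alpha by rewrite eq_sym.
have ba' : beta != alpha^*%C.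
  by rewrite -(inj_eq (can_inj (@conjcK R))) conjcK eq_sym.
have M1E := simple_factor_line LE ME ll l0 ba ba'.
have L1E := simple_factor_line ME LE mm m0 neq_alpha_beta neq_alpha_conj_beta.
exact: (simple_factor_permutability ll l0 mm m0 LE ME M1E L1E
          neq_alpha_beta neq_alpha_conj_beta t_notin).
Qed.
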